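(* Let $T\in\mathcal{B}(\mathcal{H})$ have polar decomposition $T=V|T|$. Then $$\omega(T)\le\frac{\|T\|}{2}\bigl(1+\omega(V)\bigr)\le\|T\|$$ and $$\omega(T)-\frac{\|T\|}{2}\le\frac{\|T\|}{2}\omega(V).$$
   Context: $\mathcal{H}$ is a separable nontrivial complex Hilbert space and $\mathcal{B}(\mathcal{H})$ is the algebra of bounded linear operators on $\mathcal{H}$ with the operator norm. $|T|=(T^*T)^{1/2}$. The polar decomposition of $T$ is $T=V|T|$ where $V\in\mathcal{B}(\mathcal{H})$ is the (unique) partial isometry satisfying this and $\mathcal{N}(V)=\mathcal{N}(T)$ ($\mathcal{N}$ denotes the null space). $\omega(T)=\sup\{|\langle Tx,x\rangle|:x\in\mathcal{H},\|x\|=1\}$ is the numerical radius. *)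

(* Defs.v *)
From HB Require Import structures.
From mathcomp Require Import all_boot all_order all_algebra complex.
From mathcomp Require Import all_classical all_reals topology normedtype.
Set Implicit Arguments.
Unset Strict Implicit.
Unset Printing Implicit Defensive.
Import Order.TTheory GRing.Theory Num.Theory.
Import numFieldNormedType.Exports.
Local Open Scope classical_set_scope.
Local Open Scope ring_scope.

(* A complex Hilbert space: a complete normed space over the field [R[i]] whose
   norm comes from an inner product.  As in [{dot H for Num.conj}], the inner
   product is linear in its first and conjugate-linear in its second argument. *)
HB.mixin Record NormedModule_isHilbert (R : realType) H
    of NormedModule R[i] H := {
  inner : {dot H for (@Num.conj R[i])} ;
  inner_norm : forall x : H, inner x x = `|x| ^+ 2
}.

#[short(type="hilbertType")]
HB.structure Definition Hilbert (R : realType) :=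
  {H of CompleteNormedModule R[i] H & NormedModule_isHilbert R H}.

Notation "''<' x , y >" := (inner x y)
  (at level 8, x, y at level 60, format "''<' x ,  y >") : ring_scope.

HB.mixin Record isBoundedOperator (R : realType) (H : hilbertType R)
    (T : H -> H) := {
  bounded_operator : exists M : R[i], forall x : H, `|T x| <= M * `|x|
}.

#[short(type="boundedOp")]
HB.structure Definition BoundedOperator (R : realType) (H : hilbertType R) :=
  {T of @GRing.Linear R[i] H H *:%R T & isBoundedOperator R H T}.

Notation "''B(' H )" := (boundedOp H) (format "''B(' H )") : type_scope.

Definition separable (T : topologicalType) : Prop :=
  exists2 D : set T, countable D & dense D.

(* Norms in a normed space over [R[i]] (and moduli in [R[i]] itself) have type
   [R[i]]; [rnorm x] is the same number, read in [R]. *)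
Definition rnorm (R : rcfType) (V : normedZmodType R[i]) (x : V) : R :=
  complex.Re `|x|.

Section Operators.
Context {R : realType} {H : hilbertType R}.
Implicit Types (T V A S : 'B(H)) (f : H -> H).

Definition null_space f : set H := [set x | f x = 0].

Definition opnorm T : R := sup [set rnorm (T x) | x in [set x | `|x| <= 1]].

Definition numerical_radius T : R :=
  sup [set rnorm '<T x, x> | x in [set x | `|x| = 1]].

Definition is_adjoint T S : Prop := forall x y, '<T x, y> = '<x, S y>.

(* In [R[i]], [0 <= z] says that [z] is real and nonnegative. *)
Definition positive_operator f : Prop := forall x, 0 <= '<f x, x>.

(* The positive square root is unique, so this says A = f^(1/2). *)
Definition is_positive_sqrt f A : Prop := positive_operator A /\ A \o A = f.

(* A = |T| = (T^* T)^(1/2) *)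
Definition is_absolute_value T A : Prop :=
  exists2 S, is_adjoint T S & is_positive_sqrt (S \o T) A.

(* V is isometric on the orthogonal complement of its null space. *)
Definition partial_isometry V : Prop :=
  forall x, (forall y, null_space V y -> '<x, y> = 0) -> `|V x| = `|x|.

(* T = V A is the polar decomposition of T, with A = |T| *)
Definition polar_decomposition T V A : Prop :=
  [/\ is_absolute_value T A, partial_isometry V,
      (T : H -> H) = V \o A & null_space V = null_space T].

End Operators.

(* Main.v *)
Require Import Defs.
From HB Require Import structures.
From mathcomp Require Import all_boot all_order all_algebra complex.
From mathcomp Require Import all_classical all_reals topology normedtype.
From mathcomp Require Import ring lra.
Set Implicit Arguments.
Unset Strict Implicit.
Unset Printing Implicit Defensive.
Import Order.TTheory GRing.Theory Num.Theory.
Import numFieldNormedType.Exports.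
Local Open Scope classical_set_scope.
Local Open Scope ring_scope.

(** Write [A = |T|] and [a] for the operator norm of [T].  Centring [A] at the
    middle of the interval [[0, a]] that contains its spectrum gives, for a
    unit vector [x],
      [<T x, x> = <V (A - a/2) x, x> + (a/2) <V x, x>].
    The second term is at most [(a/2) w(V)].  The first is at most
    [||V|| ||A - a/2|| <= a/2], because of two facts.

    The distance from [A] to [a/2] is at most [a/2]
    ([positive_sub_half_le]).  Expanding the square, this amounts to
    [||A x||^2 <= a <A x, x>], the operator inequality [A^2 <= a A]; it follows
    from the positivity of [A] at the single vector [a x - A x]
    ([positive_sqr_rnorm_le]).  The bound [||A x|| <= a ||x||] comes from
    [||A x|| = ||T x||] ([rnorm_absolute_value]).

    A partial isometry is a contraction ([partial_isometry_le]): subtracting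
    from [x] its orthogonal projection on the null space of [V] does not change
    [V x], and leaves a vector on which [V] is isometric.  This uses the
    projection theorem ([orthogonal_projection]), hence completeness.  It also
    gives [w(V) <= 1], which is the second inequality; the third is the first
    one rearranged.

    Norms are compared through their real values [rnorm], so that the order of
    [R] is available rather than the partial order of [R[i]]. *)

(** * Norms and inner products read in the real field *)

Section RealNorm.
Context {R : rcfType} {U : normedZmodType R[i]}.
Implicit Types x y : U.
Local Open Scope complex_scope.

Lemma rnormE x : `|x| = (rnorm x)%:C.
Proof. by rewrite /rnorm RRe_real ?normr_real. Qed.

Lemma rnorm_ge0 x : 0 <= rnorm x.
Proof. by rewrite -ler0c -rnormE. Qed.

Lemma rnorm_eq0 x : (rnorm x == 0) = (x == 0).
Proof. by rewrite -[RHS]normr_eq0 rnormE (inj_eq (@complexI R)). Qed.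

Lemma rnorm_gt0 x : (0 < rnorm x) = (x != 0).
Proof. by rewrite lt_def rnorm_ge0 andbT rnorm_eq0. Qed.

Lemma ler_rnormD x y : rnorm (x + y) <= rnorm x + rnorm y.
Proof. by rewrite -lecR rmorphD /= -!rnormE; exact: ler_normD. Qed.

End RealNorm.

Section ComplexModulus.
Context {R : rcfType}.
Implicit Types a b : R[i].
Local Open Scope complex_scope.

Lemma rnormM a b : rnorm (a * b) = rnorm a * rnorm b.
Proof. by apply: complexI; rewrite rmorphM /= -!rnormE normrM. Qed.

Lemma ler_Re_rnorm a : complex.Re a <= rnorm a.
Proof.
rewrite -lecR -rnormE; apply: le_trans (normc_ge_Re a).
by rewrite lecR ler_norm.
Qed.

Lemma rnorm_real (r : R) : 0 <= r -> rnorm r%:C = r.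
Proof. by move=> r0; rewrite /rnorm ger0_norm ?ler0c. Qed.

End ComplexModulus.

Section InnerProduct.
Context {R : realType} {H : hilbertType R}.
Implicit Types x y w : H.
Local Open Scope complex_scope.

Lemma rnormZ (a : R[i]) x : rnorm (a *: x) = rnorm a * rnorm x.
Proof. by apply: complexI; rewrite rmorphM /= -!rnormE normrZ. Qed.

Lemma innerxx x : '<x, x> = (rnorm x ^+ 2)%:C.
Proof. by rewrite inner_norm rnormE rmorphXn. Qed.

Lemma innerC x y : '<x, y> = Num.conj '<y, x>.
Proof. by rewrite hermC /= expr0 mul1r. Qed.

Lemma sqr_rnormD x y :
  rnorm (x + y) ^+ 2 = rnorm x ^+ 2 + rnorm y ^+ 2 + 2 * complex.Re '<x, y>.
Proof.
have : '<x + y, x + y> = '<x, x> + '<y, y> + ('<x, y> + Num.conj '<x, y>).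
  exact: dnormD.
rewrite !innerxx => /(congr1 (@complex.Re R)) /= ->.
by rewrite !raddfD /=; case: ('<x, y>) => u v /=; lra.
Qed.

Lemma parallelogram x y :
  rnorm (x - y) ^+ 2 + rnorm (x + y) ^+ 2 = 2 * (rnorm x ^+ 2 + rnorm y ^+ 2).
Proof.
by rewrite !sqr_rnormD [rnorm (- y)]/rnorm normrN linearNr raddfN -/(rnorm y);
  lra.
Qed.

(** The vector subtracted is the projection of [x] on the line of [w]; both
    the Cauchy-Schwarz inequality and the projection theorem come down to this
    formula. *)
Lemma sqr_rnorm_residual x w : w != 0 ->
  rnorm (x - ('<x, w> / '<w, w>) *: w) ^+ 2
  = rnorm x ^+ 2 - rnorm '<x, w> ^+ 2 / rnorm w ^+ 2.
Proof.
move=> w0; have nw0 : rnorm w != 0 by rewrite rnorm_eq0.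
rewrite sqr_rnormD -scaleNr rnormZ linearZr_LR /=.
rewrite [rnorm (- _)]/rnorm normrN -/(rnorm _) rnormM innerxx.
rewrite -fmorphV rnorm_real ?invr_ge0 ?sqr_ge0//.
have -> : Num.conj (- ('<x, w> * ((rnorm w ^+ 2)^-1)%:C)) * '<x, w>
   = - (rnorm '<x, w> ^+ 2 / rnorm w ^+ 2)%:C.
  rewrite rmorphN rmorphM /= (conj_Creal (x := _%:C)) ?complex_real//.
  by rewrite mulNr mulrAC -normCKC rnormE -rmorphXn -rmorphM.
by rewrite raddfN /=; field.
Qed.

Lemma Cauchy_Schwarz x y : rnorm '<x, y> <= rnorm x * rnorm y.
Proof.
have [->|y0] := eqVneq y 0; first by rewrite linear0r /rnorm !normr0 mulr0.
rewrite -ler_sqr ?nnegrE ?mulr_ge0 ?rnorm_ge0// exprMn.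
rewrite -ler_pdivrMr ?exprn_gt0 ?rnorm_gt0// -subr_ge0 -sqr_rnorm_residual//.
exact: sqr_ge0.
Qed.

End InnerProduct.

(** * The projection theorem *)

Section Projection.
Context {R : realType} {H : hilbertType R}.
Context (N : set H) (x : H) (N_closed : closed N) (N0 : N 0).
Context (N_linear : forall (a : R[i]) u v, N u -> N v -> N (a *: u + v)).
Local Open Scope complex_scope.

Let sqdist : R := inf [set rnorm (x - y) ^+ 2 | y in N].

Let sqdist_le y : N y -> sqdist <= rnorm (x - y) ^+ 2.
Proof.
move=> Ny; apply: ge_inf; last by exists y.
by exists 0 => _ [z _ <-]; apply: sqr_ge0.
Qed.

Let near_point (e : R) := N `&` [set y | rnorm (x - y) ^+ 2 <= sqdist + e].

Let near_point_nonempty e : 0 < e -> near_point e !=set0.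
Proof.
move=> e0; have /(inf_adherent e0) [_ [y Ny <-] yd] :
    has_inf [set rnorm (x - y) ^+ 2 | y in N].
  split; first by exists (rnorm (x - 0) ^+ 2); exists 0.
  by exists 0 => _ [z _ <-]; apply: sqr_ge0.
by exists y; split => //; apply: ltW.
Qed.

(** The midpoint of [y] and [z] lies in [N], hence is no closer to [x] than the
    infimum; the parallelogram law then leaves little room between [y] and
    [z]. *)
Let near_point_close e y z : near_point e y -> near_point e z ->
  rnorm (y - z) ^+ 2 <= 4 * e.
Proof.
move=> [Ny /= dy] [Nz /= dz].
pose m := (2^-1 : R[i]) *: (y + z).
have Nm : N m.
  rewrite /m -[_ *: _]addr0; apply: N_linear => //.
  by rewrite -[y]scale1r; apply: N_linear.
have := parallelogram (x - z) (x - y).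
have -> : x - z - (x - y) = y - z by rewrite opprB addrC subrKA.
have -> : x - z + (x - y) = (2 : R[i]) *: (x - m).
  rewrite /m scalerBr scalerA divff ?pnatr_eq0// scale1r scaler_nat mulr2n.
  by rewrite addrACA [- z + _]addrC opprD.
rewrite rnormZ exprMn.
have -> : rnorm (2 : R[i]) = 2 :> R.
  by rewrite /rnorm normr_nat raddfMn.
by have := sqdist_le Nm; lra.
Qed.

(** A minimising filter, playing the part of a minimising sequence without a
    choice of points. *)
Let F : set_system H := filter_from [set e | 0 < e] near_point.

Let F_proper : ProperFilter F.
Proof.
apply: filter_from_proper => [|e]; last exact: near_point_nonempty.
apply: filter_from_filter; first by exists 1 => /=.
move=> a b a0 b0; exists (Num.min a b); first by rewrite /= lt_min a0.
have h c : Num.min a b <= c -> near_point (Num.min a b) `<=` near_point c.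
  by move=> mc y [Ny /= yd]; split => //=; apply: le_trans yd _; rewrite lerD2l.
by move=> y yab; split; apply: h yab; rewrite ge_min lexx ?orbT.
Qed.

Let F_cvg : cvg F.
Proof.
have FF := F_proper; apply/cauchy_cvgP/cauchy_exP => e e0.
have [r er] : exists r : R, e = r%:C by apply/complex_realP; apply: gtr0_real.
move: e0; rewrite er ltcR => r0.
(* Points of [near_point d] are within [2 * sqrt d] of each other, so any
   [d < r ^+ 2 / 4] will do. *)
have d0 : 0 < r ^+ 2 / 8 by rewrite divr_gt0 ?exprn_gt0.
have [y dy] := near_point_nonempty d0.
exists y; exists (r ^+ 2 / 8) => //= z dz; rewrite -ball_normE /= rnormE ltcR.
rewrite -ltr_sqr ?nnegrE ?rnorm_ge0 ?ltW//.
by apply: le_lt_trans (near_point_close dy dz) _; nra.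
Qed.

(** The limit [p] of the minimising filter attains the distance from [x] to [N];
    a component of [x - p] along some [w] in [N] could be moved into [p] to
    come strictly closer. *)
Theorem orthogonal_projection :
  exists2 p, N p & forall w, N w -> '<x - p, w> = 0.
Proof.
have [p Fp] := (cvg_ex F).1 F_cvg.
have Np : N p.
  apply: N_closed => B Bp; have [e e0 eB] := Fp _ Bp.
  have [y dy] := near_point_nonempty e0.
  by exists y; split; [exact: (dy.1) | exact: eB].
exists p => //.
have sqdist0 : 0 <= sqdist.
  by apply: lb_le_inf; [exists (rnorm (x - 0) ^+ 2); exists 0
    | move=> _ [z _ <-]; apply: sqr_ge0].
have xp_min : rnorm (x - p) ^+ 2 <= sqdist.
  rewrite -[leRHS]sqr_sqrtr// ler_sqr ?nnegrE ?rnorm_ge0 ?sqrtr_ge0//.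
  apply/ler_addgt0Pr => e e0.
  have e2 : 0 < e / 2 by rewrite divr_gt0.
  have /Fp[d d0 dB] : nbhs p (ball p (e / 2)%:C).
    by apply: nbhsx_ballx; rewrite ltcR.
  (* The minimum makes [z] both close to [p] and nearly as close to [x] as the
     infimum; the square is what [Num.sqrt] turns into an excess of [e / 2]. *)
  have m0 : 0 < Num.min d ((e / 2) ^+ 2) by rewrite lt_min d0 exprn_gt0.
  have [z [Nz /= dz]] := near_point_nonempty m0.
  have zp : rnorm (z - p) < e / 2.
    have /dB : near_point d z.
      by split => //=; apply: le_trans dz _; rewrite lerD2l ge_min lexx.
    by rewrite -ball_normE /= distrC rnormE ltcR.
  have xz : rnorm (x - z) <= Num.sqrt sqdist + e / 2.
    rewrite -ler_sqr ?nnegrE ?rnorm_ge0 ?addr_ge0 ?sqrtr_ge0 ?(ltW e2)//.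
    apply: (le_trans dz); rewrite sqrrD sqr_sqrtr// -addrA lerD2l.
    apply: (@le_trans _ _ ((e / 2) ^+ 2)); first by rewrite ge_min lexx orbT.
    by rewrite lerDr mulrn_wge0// mulr_ge0 ?sqrtr_ge0 ?ltW.
  by rewrite -(subrKA z); apply: le_trans (ler_rnormD _ _) _; lra.
move=> w Nw; have [->|w0] := eqVneq w 0; first exact: linear0r.
apply/eqP; rewrite -rnorm_eq0 -sqrf_eq0 eq_le sqr_ge0 andbT.
have w2 : 0 < rnorm w ^+ 2 by rewrite exprn_gt0 ?rnorm_gt0.
have : sqdist <= rnorm (x - p - ('<x - p, w> / '<w, w>) *: w) ^+ 2.
  by rewrite -addrA -opprD; apply: sqdist_le; rewrite addrC; apply: N_linear.
rewrite sqr_rnorm_residual// => le1.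
by rewrite -(pmulr_lle0 _ (_ : 0 < (rnorm w ^+ 2)^-1)) ?invr_gt0// mulrC; lra.
Qed.

End Projection.

(** * Bounds for operators *)

Section OperatorBounds.
Context {R : realType} {H : hilbertType R}.
Implicit Types (T V A : 'B(H)) (x y : H) (c : R).
Local Open Scope complex_scope.

Lemma rnorm_bounded T :
  exists2 K : R, 0 <= K & forall x, rnorm (T x) <= K * rnorm x.
Proof.
have [[M M'] TM] := @bounded_operator _ _ T.
exists `|M| => // x; have := TM x.
rewrite !rnormE lecE => /andP[_] /=; rewrite mulr0 subr0 => /le_trans; apply.
by rewrite ler_wpM2r ?rnorm_ge0 ?ler_norm.
Qed.

Lemma has_ubound_opnorm T :
  has_ubound [set rnorm (T x) | x in [set x | `|x| <= 1]].
Proof.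
have [K K0 TK] := rnorm_bounded T; exists K => _ [x /= x1 <-].
apply: le_trans (TK x) _; rewrite ler_piMr//.
by move: x1; rewrite rnormE lecR.
Qed.

Lemma opnorm_ge0 T : 0 <= opnorm T.
Proof.
apply: le_trans (rnorm_ge0 (T 0)) _.
by apply: (ub_le_sup (has_ubound_opnorm T)); exists 0; rewrite //= normr0 ler01.
Qed.

Lemma opnorm_bound T x : rnorm (T x) <= opnorm T * rnorm x.
Proof.
have [->|x0] := eqVneq x 0; first by rewrite linear0 /rnorm !normr0 mulr0.
have nx0 : 0 < rnorm x by rewrite rnorm_gt0.
have xE : x = (rnorm x)%:C *: ((rnorm x)^-1%:C *: x).
  by rewrite scalerA -rmorphM divff ?gt_eqF// scale1r.
rewrite {1}xE linearZ rnormZ rnorm_real ?rnorm_ge0// mulrC ler_pM2r//.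
apply: (ub_le_sup (has_ubound_opnorm T)); exists ((rnorm x)^-1%:C *: x) => //=.
by rewrite rnormE rnormZ rnorm_real ?invr_ge0 ?rnorm_ge0// mulVf ?gt_eqF// lecR.
Qed.

Lemma numerical_radius_bound T x : `|x| = 1 ->
  rnorm '<T x, x> <= numerical_radius T.
Proof.
move=> x1; apply: ub_le_sup; last by exists x.
exists (opnorm T) => _ [y /= y1 <-].
have ny : rnorm y = 1 by rewrite /rnorm y1.
apply: le_trans (Cauchy_Schwarz _ _) _; rewrite ny mulr1.
by apply: le_trans (opnorm_bound T y) _; rewrite ny mulr1.
Qed.

Lemma numerical_radius_le T c : (exists x : H, x != 0) ->
  (forall x, `|x| = 1 -> rnorm '<T x, x> <= c) -> numerical_radius T <= c.
Proof.
move=> [x x0] Tc; apply: ge_sup => [|_ [y /= y1 <-]]; last exact: Tc.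
have nx0 : rnorm x != 0 by rewrite rnorm_eq0.
pose u := (rnorm x)^-1%:C *: x; exists (rnorm '<T u, u>); exists u => //=.
by rewrite rnormE rnormZ rnorm_real ?invr_ge0 ?rnorm_ge0// mulVf.
Qed.

Lemma closed_null_space V : closed (null_space V).
Proof.
move=> p pN; have [K K0 VK] := rnorm_bounded V.
apply/eqP; rewrite -rnorm_eq0 eq_le rnorm_ge0 andbT.
apply/ler_addgt0Pr => e e0; rewrite add0r.
have K1 : 0 < K + 1 by rewrite ltr_wpDl.
have d0 : 0 < e / (K + 1) by rewrite divr_gt0.
have [z [/= Vz]] : null_space V `&` ball p (e / (K + 1))%:C !=set0.
  by apply: pN; apply: nbhsx_ballx; rewrite ltcR.
rewrite -ball_normE /= rnormE ltcR => pz.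
rewrite -[V p]subr0 -Vz -linearB; apply: le_trans (VK _) _.
move: pz; rewrite ltr_pdivlMr// => /ltW; apply: le_trans.
by rewrite mulrC ler_wpM2l ?rnorm_ge0// lerDl.
Qed.

(** [x] and its component orthogonal to the null space have the same image, and
    that component is no longer than [x]. *)
Lemma partial_isometry_le V x : partial_isometry V -> rnorm (V x) <= rnorm x.
Proof.
move=> Viso; have [p Vp xp] : exists2 p, null_space V p &
    forall w, null_space V w -> '<x - p, w> = 0.
  apply: orthogonal_projection; first exact: closed_null_space.
    by rewrite /null_space /= linear0.
  move=> a u v Vu Vv; rewrite /null_space /=.
  by rewrite linearP /= (Vu : V u = 0) (Vv : V v = 0) scaler0 addr0.
have -> : V x = V (x - p) by rewrite linearB /= (Vp : V p = 0) subr0.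
rewrite /rnorm (Viso _ xp) -!/(rnorm _) -ler_sqr ?nnegrE ?rnorm_ge0//.
by rewrite -{2}(subrK p x) (sqr_rnormD (x - p)) xp// mulr0 addr0 lerDl sqr_ge0.
Qed.

(** Polarization: over the complex numbers a form with real diagonal values is
    Hermitian. *)
Lemma positive_symmetric A : positive_operator A ->
  forall x y, '<A x, y> = '<x, A y>.
Proof.
move=> Apos x y; rewrite [RHS]innerC.
have Im0 u v : complex.Im ('<A u, v> + '<A v, u>) = 0.
  have := ger0_Im (Apos (u + v)).
  rewrite (linearD A) /= linearDl !linearDr /= -[_ + _ + _]addrA.
  by rewrite [_ + (_ + _)]addrCA !raddfD /= !(ger0_Im (Apos _)) !(add0r, addr0).
(* The pair [x, y] compares imaginary parts, and [x, 'i *: y] real parts. *)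
have := Im0 x y; have := Im0 x ('i *: y)%C.
rewrite (linearZ_LR A) /= linearZl_LR linearZr_LR /=.
case: ('<A x, y>) => a b; case: ('<A y, x>) => c d /=.
rewrite !(mul0r, mul1r, subr0, oppr0, add0r, addr0, mulN1r) => h1 h2.
by congr Complex; lra.
Qed.

(** The operator inequality [A ^ 2 <= c A].  Positivity of [A] at [c x - A x],
    together with [<A (A x), A x> <= c ||A x||^2], gives
    [0 <= c (c <A x, x> - ||A x||^2)], where [c] can be cancelled unless it
    is [0], in which case [A = 0]. *)
Lemma positive_sqr_rnorm_le A c x : positive_operator A -> 0 <= c ->
  (forall y, rnorm (A y) <= c * rnorm y) ->
  rnorm (A x) ^+ 2 <= c * complex.Re '<A x, x>.
Proof.
move=> Apos; rewrite le_eqVlt => /predU1P[<-|c0] Ac.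
  rewrite mul0r; have := Ac x; rewrite mul0r => Ax.
  have -> : rnorm (A x) = 0 by apply/eqP; rewrite eq_le Ax rnorm_ge0.
  by rewrite expr0n.
set z := c%:C *: x - A x.
have : 0 <= complex.Re '<A z, z> by have := Apos z; rewrite lecE => /andP[].
have cCreal : Num.conj c%:C = c%:C by apply: conj_Creal; rewrite complex_real.
rewrite /z (linearB A) /= (linearZ_LR A) /= linearBl !linearBr /=.
rewrite !linearZl_LR !linearZr_LR /= cCreal.
rewrite (positive_symmetric Apos (A x) x) innerxx.
have AAx : complex.Re '<A (A x), A x> <= c * rnorm (A x) ^+ 2.
  apply: le_trans (ler_Re_rnorm _) _; apply: le_trans (Cauchy_Schwarz _ _) _.
  by rewrite expr2 mulrA ler_wpM2r ?rnorm_ge0.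
case: ('<A x, x>) => q q' /=; case: ('<A (A x), A x>) AAx => s s' /= AAx.
rewrite !(mul0r, subr0, mulr0) => h.
by rewrite -(ler_pM2l c0); lra.
Qed.

(** The square of the left-hand side is [||A x||^2 - c <A x, x>] plus the square
    of the right-hand side. *)
Lemma positive_sub_half_le A c x : positive_operator A -> 0 <= c ->
  (forall y, rnorm (A y) <= c * rnorm y) ->
  rnorm (A x - (c / 2)%:C *: x) <= c / 2 * rnorm x.
Proof.
move=> Apos c0 Ac; have h := positive_sqr_rnorm_le x Apos c0 Ac.
have c2 : 0 <= c / 2 by rewrite divr_ge0.
rewrite -ler_sqr ?nnegrE ?(mulr_ge0 c2) ?rnorm_ge0//.
have cCreal : Num.conj (- (c / 2)%:C) = - (c / 2)%:C.
  by apply: conj_Creal; rewrite -rmorphN complex_real.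
rewrite sqr_rnormD -scaleNr rnormZ linearZr_LR /= cCreal.
rewrite [rnorm (- _)]/rnorm normrN -/(rnorm _) rnorm_real//.
rewrite -rmorphN; move: h; case: ('<A x, x>) => q q' /=.
by rewrite mul0r subr0; lra.
Qed.

Lemma rnorm_absolute_value T A x : is_absolute_value T A ->
  rnorm (A x) = rnorm (T x).
Proof.
case=> S TS [Apos AA]; apply/eqP; rewrite -(eqrXn2 (n := 2)) ?rnorm_ge0//.
apply/eqP/complexI; rewrite -!innerxx TS -positive_symmetric//.
rewrite [RHS]innerC -[S (T x)]/((S \o T) x) -AA /= -innerC.
by rewrite -!positive_symmetric.
Qed.

End OperatorBounds.

(** * The numerical radius inequality *)

Theorem proposition4p1 (R : realType) (H : hilbertType R)
    (H_separable : separable H) (H_nontrivial : exists x : H, x != 0)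
    (T V absT : 'B(H)) (T_polar : polar_decomposition T V absT) :
  (numerical_radius T <= opnorm T / 2 * (1 + numerical_radius V) <= opnorm T)
  /\ numerical_radius T - opnorm T / 2 <= opnorm T / 2 * numerical_radius V.
Proof.
case: T_polar => absTP Viso TVA _.
have a0 := opnorm_ge0 T; set a := opnorm T in a0 *.
have Apos : positive_operator absT by case: absTP => S _ [].
have Aa y : rnorm (absT y) <= a * rnorm y.
  by rewrite (rnorm_absolute_value _ absTP); exact: opnorm_bound.
have wV1 : numerical_radius V <= 1.
  apply: numerical_radius_le => // x x1.
  have nx : rnorm x = 1 by rewrite /rnorm x1.
  apply: le_trans (Cauchy_Schwarz _ _) _; rewrite nx mulr1 -nx.
  exact: partial_isometry_le.
have wT : numerical_radius T <= a / 2 * (1 + numerical_radius V).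
  apply: numerical_radius_le => // x x1.
  have nx : rnorm x = 1 by rewrite /rnorm x1.
  pose y := absT x - (a / 2)%:C%C *: x.
  have a2 : 0 <= a / 2 by rewrite divr_ge0.
  have -> : '<T x, x> = '<V y, x> + (a / 2)%:C%C * '<V x, x>.
    by rewrite TVA /= -linearZl_LR -linearDl -linearZ -linearD subrK.
  apply: le_trans (ler_rnormD _ _) _; rewrite mulrDr mulr1 lerD//.
    apply: le_trans (Cauchy_Schwarz _ _) _; rewrite nx mulr1.
    apply: le_trans (partial_isometry_le _ Viso) _.
    by apply: le_trans (positive_sub_half_le _ Apos a0 Aa) _; rewrite nx mulr1.
  by rewrite rnormM rnorm_real// ler_wpM2l// numerical_radius_bound.
by split; [apply/andP; split=> // |]; nra.
Qed.
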